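(* Let $(\mathsf{Gen},\mathsf{Sign},\mathsf{Ver})$ be a one-time oracle signature scheme with perfect completeness in the random oracle model for a message space $\mathcal{M}$, in which the total number of oracle queries asked by $\mathsf{Gen}$, $\mathsf{Sign}$ and $\mathsf{Ver}$ is at most $q$. Let $\lambda,\delta>0$ and suppose $|\mathcal{M}|\ge \binom{q}{q/2}/\lambda$. Then there is a (computationally unbounded) adversary which asks at most $O\!\left(\frac{q^2\binom{q}{q/2}}{\lambda\delta^2}\right)=O\!\left(\frac{q^{1.5}2^q}{\lambda\delta^2}\right)$ oracle queries and breaks the scheme with probability $1-(\lambda+\delta)$, where this probability is over the randomness of the oracle, the coin tosses of the key generation algorithm, and the coin tosses of the adversary.
   Context: Random oracle: for each input length $\ell$, an independent uniformly random function $\{0,1\}^\ell\to\{0,1\}^\ell$, accessible only by queries. An oracle signature scheme with perfect completeness for $\mathcal{M}$ is a triple of oracle algorithms $(\mathsf{Gen},\mathsf{Sign},\mathsf{Ver})$ ($\mathsf{Gen}$ possibly probabilistic, outputting $(SK,VK)$) such that for every oracle $\mathcal{O}$, every $(SK,VK)$ output by $\mathsf{Gen}^{\mathcal{O}}$ with positive probability and every $\alpha\in\mathcal{M}$, $\mathsf{Ver}^{\mathcal{O}}(VK,\alpha,\mathsf{Sign}^{\mathcal{O}}(SK,\alpha))=1$. The total number of queries is counted over generating the keys, signing one message and verifying that signature. Breaking the (one-time) scheme: the adversary receives $VK$, chooses a message $\alpha\in\mathcal{M}$ (independently of $VK$), receives $\sigma=\mathsf{Sign}^{\mathcal{O}}(SK,\alpha)$,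 may query the oracle, and outputs $(\alpha^*,\sigma^* )$; it breaks the scheme if $\alpha^*\ne\alpha$ and $\mathsf{Ver}^{\mathcal{O}}(VK,\alpha^*,\sigma^* )=1$. Oracle queries made by the adversary include all queries it makes in any computation it performs. *)

(* Defs.v *)
From mathcomp Require Import all_boot all_order all_algebra.
From mathcomp Require Import all_classical all_reals all_analysis.

Set Implicit Arguments.
Unset Strict Implicit.
Unset Printing Implicit Defensive.
Import Order.TTheory GRing.Theory Num.Theory.
Import numFieldNormedType.Exports.

Local Open Scope classical_set_scope.
Local Open Scope ring_scope.

Definition oracle : Type := forall l : nat, l.-tuple bool -> l.-tuple bool.

(* A deterministic oracle algorithm: its tree of queries. Trees are
   well-founded, so algorithms halt on every oracle; the local computation
   between two queries is unrestricted. *)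
Inductive oalg (A : Type) : Type :=
| Return of A
| Query (l : nat) (x : l.-tuple bool) of (l.-tuple bool -> oalg A).

Fixpoint run (O : oracle) (A : Type) (p : oalg A) : A :=
  match p with
  | Return a => a
  | Query l x k => run O (k (O l x))
  end.

(* Repeated queries are counted each time they are asked. *)
Fixpoint nqueries (O : oracle) (A : Type) (p : oalg A) : nat :=
  match p with
  | Return _ => 0
  | Query l x k => (nqueries O (k (O l x))).+1
  end.

(* The randomness of a probabilistic algorithm: an arbitrary discrete
   probability distribution. A probabilistic oracle algorithm is a family of
   deterministic ones indexed by the outcome of its coins. *)
Record coins (R : realType) : Type := Coins {
  outcome : countType;
  pmf : outcome -> R;
  pmf_ge0 : forall c, 0 <= pmf c;
  pmf_sum1 : (\esum_(c in [set: outcome]) (pmf c)%:E = 1)%E }.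

Record scheme (R : realType) (M : Type) : Type := Scheme {
  skey : Type;
  vkey : Type;
  signature : Type;
  gen_coins : coins R;
  gen : outcome gen_coins -> oalg (skey * vkey);
  sign : skey -> M -> oalg signature;
  ver : vkey -> M -> signature -> oalg bool }.

Definition perfectly_complete (R : realType) (M : Type) (S : scheme R M) : Prop :=
  forall (O : oracle) (g : outcome (gen_coins S)), 0 < pmf g ->
  forall m : M,
    let: (sk, vk) := run O (gen g) in
    run O (ver vk m (run O (sign sk m))) = true.

Definition total_queries_le (R : realType) (M : Type) (S : scheme R M) (q : nat)
    : Prop :=
  forall (O : oracle) (g : outcome (gen_coins S)), 0 < pmf g ->
  forall m : M,
    let: (sk, vk) := run O (gen g) in
    (nqueries O (gen g) + nqueries O (sign sk m)
     + nqueries O (ver vk m (run O (sign sk m))) <= q)%N.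

(* The message to be signed is a function of the adversary's coins only, hence
   independent of the oracle and of the verification key. *)
Record adversary (R : realType) (M : Type) (S : scheme R M) : Type := Adversary {
  adv_coins : coins R;
  adv_msg : outcome adv_coins -> M;
  adv_forge : outcome adv_coins -> vkey S -> signature S -> oalg (M * signature S) }.

Definition adv_queries_le (R : realType) (M : Type) (S : scheme R M)
    (A : adversary S) (b : R) : Prop :=
  forall (O : oracle) (a : outcome (adv_coins A)) (vk : vkey S) (s : signature S),
    (nqueries O (adv_forge a vk s))%:R <= b.

Definition breaks (R : realType) (M : Type) (S : scheme R M) (A : adversary S)
    (O : oracle) (g : outcome (gen_coins S)) (a : outcome (adv_coins A)) : Prop :=
  let: (sk, vk) := run O (gen g) in
  let m := adv_msg a in
  let: (m', s') := run O (adv_forge a vk (run O (sign sk m))) in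
  m' <> m /\ run O (ver vk m' s') = true.

(* The functions [O w l], for l : nat, are independent and each is uniform
   among the functions from l-bit strings to l-bit strings. *)
Definition random_oracle (R : realType) (d : measure_display)
    (Omega : measurableType d) (P : probability Omega R) (O : Omega -> oracle)
    : Prop :=
  forall (L : nat) (f : oracle),
    let E := [set w | forall l, (l < L)%N -> O w l =1 f l] in
    measurable E /\
    P E = (\prod_(l < L) (#|{ffun l.-tuple bool -> l.-tuple bool}|%:R)^-1)%:E.

Section existence.
Variable R : realType.

Let F (l : nat) : finType := {ffun l.-tuple bool -> l.-tuple bool}.
Let pr (L : nat) : nat := \prod_(l < L) #|F l|.

Let F_gt0 l : (0 < #|F l|)%N.
Proof. by apply/card_gt0P; exists [ffun x => x]. Qed.

Let pr_gt0 L : (0 < pr L)%N.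
Proof. by rewrite prodn_gt0. Qed.

Let prS L : pr L.+1 = (pr L * #|F L|)%N.
Proof. by rewrite /pr big_ord_recr. Qed.

Let u (w : R) : R := if (0 <= w) && (w < 1) then w else 0.
Let N L (w : R) : nat := Num.truncn (u w * (pr L)%:R).

Let u_itv w : 0 <= u w < 1.
Proof. by rewrite /u; case: ifP => //; rewrite lexx ltr01. Qed.

Let N0 w : N 0 w = 0%N.
Proof.
rewrite /N /pr big_ord0 mulr1; apply: truncn_def.
by have := u_itv w.
Qed.

Let NP L w k : N L w = k <-> k%:R <= u w * (pr L)%:R < k.+1%:R.
Proof.
have /andP[u0 _] := u_itv w.
split=> [<-|]; last exact: truncn_def.
by apply: truncn_itv; rewrite mulr_ge0.
Qed.

Let NS L w : (N L.+1 w %/ #|F L|)%N = N L w.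
Proof.
apply/esym/NP; have /(_ erefl) := (NP L.+1 w (N L.+1 w)).1.
set n := N L.+1 w => /andP[n1 n2].
have m0 : (0 : R) < #|F L|%:R by rewrite ltr0n.
have e : u w * (pr L.+1)%:R = u w * (pr L)%:R * #|F L|%:R :> R.
  by rewrite prS natrM mulrA.
rewrite e in n1 n2.
apply/andP; split.
  rewrite -(ler_pM2r m0); apply: le_trans n1.
  by rewrite -natrM ler_nat leq_divM.
rewrite -(ltr_pM2r m0); apply: lt_le_trans n2 _.
by rewrite -natrM ler_nat ltn_ceil.
Qed.

Let digit_lt l w : (N l.+1 w %% #|F l| < #|F l|)%N.
Proof. exact: ltn_pmod. Qed.

Let Or (w : R) : oracle := fun l => enum_val (Ordinal (digit_lt l w)) : F l.

Let rk (f : oracle) l : nat := enum_rank (finfun (f l) : F l).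

Let OrP w f l : @Or w l =1 f l <-> (N l.+1 w %% #|F l|)%N = rk f l.
Proof.
rewrite /Or /rk; split=> [e|e x].
  have -> : finfun (f l) = enum_val (Ordinal (digit_lt l w)) :> F l.
    by apply/ffunP => x; rewrite ffunE e.
  by rewrite enum_valK.
have -> : Ordinal (digit_lt l w) = enum_rank (finfun (f l) : F l).
  exact/val_inj.
by rewrite enum_rankK ffunE.
Qed.

Let K (f : oracle) : nat -> nat :=
  fix K L := if L is L'.+1 then (K L' * #|F L'| + rk f L')%N else 0%N.

Let rk_lt f l : (rk f l < #|F l|)%N.
Proof. exact: ltn_ord. Qed.

Let KP f L w : (forall l, (l < L)%N -> @Or w l =1 f l) <-> N L w = K f L.
Proof.
elim: L => [|L IH]; first by rewrite N0.
split=> [h|h].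
  have hL : N L w = K f L by apply/IH => l lL; apply: h; rewrite ltnW.
  by rewrite (divn_eq (N L.+1 w) #|F L|) NS hL (OrP w f L).1//; exact: h.
have h1 : N L w = K f L.
  by rewrite -NS h /= divnMDl// (divn_small (rk_lt f L)) addn0.
have h2 : (N L.+1 w %% #|F L|)%N = rk f L.
  by rewrite h /= modnMDl modn_small.
move=> l; rewrite ltnS leq_eqVlt => /predU1P[->|lL]; first exact/OrP.
by move: l lL; apply/IH.
Qed.

Let K_lt f L : (K f L < pr L)%N.
Proof.
elim: L => [|L IH] /=; first by rewrite /pr big_ord0.
rewrite prS; apply: (@leq_trans (K f L * #|F L| + #|F L|)).
  by rewrite ltn_add2l.
by rewrite addnC -mulSn leq_mul2r IH orbT.
Qed.

Let measurable_u : measurable_fun setT u.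
Proof.
rewrite /u; apply: measurable_fun_if => //=.
by apply: measurable_and => //; [exact: measurable_realfun.measurable_fun_ler|
  exact: measurable_realfun.measurable_fun_ltr].
Qed.

(* Lebesgue measure on the unit interval carries a random oracle: the mixed
   radix digits of w are independent and uniform, and the digit of rank l
   selects the l-th function. *)
Lemma random_oracle_exists :
  exists (d : measure_display) (Omega : measurableType d)
    (P : probability Omega R) (O : Omega -> oracle), random_oracle P O.
Proof.
exists _, (measurableTypeR R), (uniform_prob (@ltr01 R)), Or => L f E.
set a := (K f L)%:R / (pr L)%:R : R.
set b := (K f L).+1%:R / (pr L)%:R : R.
have p0 : (0 : R) < (pr L)%:R by rewrite ltr0n.
have EE : E = u @^-1` `[a, b[.
  apply/seteqP; split => w; rewrite /E /= in_itv /= /a /b.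
    move=> /KP /NP /andP[h1 h2].
    by rewrite ler_pdivrMr// ltr_pdivlMr// h1.
  rewrite ler_pdivrMr// ltr_pdivlMr// => h.
  by apply/KP/NP.
have mE : measurable E.
  by rewrite EE -[X in measurable X]setTI; apply: measurable_u.
split => //.
have a0 : 0 <= a by rewrite divr_ge0.
have b1 : b <= 1 by rewrite ler_pdivrMr// mul1r ler_nat.
have ab : a < b by rewrite ltr_pM2r ?invr_gt0// ltr_nat.
have -> : (\prod_(l < L) (#|F l|%:R)^-1)%R = b - a.
  rewrite prodfV -natr_prod -mulrBl.
  by rewrite -natr1 [_ + 1]addrC addrK mul1r.
rewrite /= /uniform_prob integral_uniform_pdf.
have mE1 : measurable (E `&` `[0 : R, 1]) by exact: measurableI.
rewrite (eq_integral (cst 1%E)); last first.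
  move=> x; rewrite inE /= in_itv /= => -[_ x01].
  by rewrite /uniform_pdf x01 subr0 invr1.
rewrite integral_cst// mul1e.
have Iab : lebesgue_measure (`[a, b[ : set R) = (b - a)%:E.
  by rewrite lebesgue_measure_itv /= lte_fin ab -EFinB.
apply/eqP; rewrite eq_le; apply/andP; split.
  apply: (@le_trans _ _ (lebesgue_measure (`[a, b[ `|` [set (1 : R)]))).
    apply: le_measure; rewrite ?inE//; first exact: measurableU.
    move=> w [Ew /=]; rewrite in_itv /= => /andP[w0].
    rewrite le_eqVlt => /predU1P[->|w1]; first by right.
    by left; move: Ew; rewrite EE /= /u w0 w1.
  rewrite -[leRHS]adde0 -(lebesgue_measure_set1 (1 : R)) -Iab.
  exact: measureU2.
rewrite -Iab; apply: le_measure; rewrite ?inE// => w /=.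
rewrite in_itv /= => /andP[aw wb].
have w0 : 0 <= w by exact: le_trans aw.
have w1 : w < 1 by exact: lt_le_trans b1.
split; last by rewrite in_itv /= w0 ltW.
by rewrite EE /= /u w0 w1 /= in_itv /= aw.
Qed.

End existence.

(* The coins of key generation, those of the adversary and the oracle are
   mutually independent. *)
Definition success_prob (R : realType) (M : Type) (S : scheme R M)
    (A : adversary S) (d : measure_display) (Omega : measurableType d)
    (P : probability Omega R) (O : Omega -> oracle) : \bar R :=
  (\esum_(c in [set: outcome (gen_coins S) * outcome (adv_coins A)])
     (pmf c.1 * pmf c.2)%:E * P [set w | breaks (O w) c.1 c.2])%E.

Definition card_ge (R : realType) (M : Type) (r : R) : Prop :=
  exists2 n : nat, r <= n%:R & (`I_n #<= [set: M])%card.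

(* Main.v *)
Require Import Defs.
From mathcomp Require Import all_boot all_order all_algebra.
From mathcomp Require Import all_classical all_reals all_analysis.
From mathcomp Require Import ring lra zify.
Import Order.TTheory GRing.Theory Num.Theory.
Local Open Scope ring_scope.

Set Implicit Arguments.
Unset Strict Implicit.
Unset Printing Implicit Defensive.

(* On receiving a signature of one message alpha, the adversary repeatedly asks
   every point which, given its view, is likely to be queried somewhere in key
   generation or in the honest signing and verification of some message. A point
   asked in this way is relevant with probability at least eps, and at most q |M|
   points are relevant, so this stops early. The adversary then imagines a world
   (oracle and key generation coins) consistent with its view, patches the real
   oracle with the imagined one on the queries of Gen and Sign(alpha), and signs
   the other messages in the hybrid world. Exchanging the answers of the real
   and the imagined oracle outside these queries is an involution preserving the
   distribution, so up to the small probability of hitting an unlikely point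
   the hybrid is distributed like an honest world. The forgery on beta is
   accepted by the real oracle as soon as Ver(beta) meets Gen and Sign(alpha)
   only inside Ver(alpha), where the two oracles agree. The messages alpha for
   which no such beta exists form, with A = (Gen + Sign(alpha)) \ Ver(alpha) and
   B = Ver(alpha), a cross-intersecting family of set pairs, so by Bollobas'
   inequality there are at most 'C(q, q/2) of them.

   Everything is finite once the coins of Gen are cut down to a finite set of
   mass 1 - delta/4, since query trees are finitely branching; by averaging, the
   random choices of the adversary (alpha and the imagined world) can be fixed,
   hence the adversary below uses no coins. *)

(** * Binomial coefficients and Bollobas' set pairs inequality *)

Lemma bin_le_central (n k : nat) : ('C(n, k) <= 'C(n, n %/ 2))%N.
Proof.
have up j : (j <= n %/ 2)%N -> forall i, (i <= j)%N -> ('C(n, i) <= 'C(n, j))%N.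
  elim: j => [|j IH] jn i; first by rewrite leqn0 => /eqP ->.
  rewrite leq_eqVlt => /predU1P[->//|]; rewrite ltnS => ij.
  apply: leq_trans (IH (ltnW jn) _ ij) _.
  rewrite -(leq_pmul2l (ltn0Sn j)) mul_bin_left leq_mul2r.
  by apply/orP; right; lia.
have [kn|nk] := leqP k (n %/ 2); first exact: up.
have [kn|nk'] := leqP k n; last by rewrite bin_small.
by rewrite -bin_sub//; apply: up => //; lia.
Qed.

Lemma bin_central_monotone (m n : nat) :
  (m <= n)%N -> ('C(m, m %/ 2) <= 'C(n, n %/ 2))%N.
Proof.
move=> mn; apply: leq_trans (bin_le_central n (m %/ 2)).
by apply: leq_bin2l.
Qed.

(** This saves the factor [sqrt q] in the second form of the query bound. Even [n] goes by induction
    in the stronger form with [n + 1]; odd [n] follows because ['C(2j+1, j)] is at most twice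
    ['C(2j, j)]. *)
Lemma bin_central_sqr_le (n : nat) : ('C(n, n %/ 2) ^ 2 * n <= 4 ^ n)%N.
Proof.
have ev j : ('C(j.*2, j) ^ 2 * j.*2.+1 <= 16 ^ j)%N.
  elim: j => [//|j IH].
  have e1 : (j.+1 * 'C(j.+1.*2, j.+1) = j.*2.+1.*2 * 'C(j.*2, j))%N.
    have h1 := mul_bin_diag j.*2.+2 j; have h2 := mul_bin_down j.*2.+1 j.
    have -> : j.+1.*2 = j.*2.+2 by lia.
    rewrite -h1 /=; have -> : (j.*2.+2 = 2 * j.+1)%N by lia.
    have e2 : (j.*2.+1 - j = j.+1)%N by lia.
    move: h2; rewrite e2 /= => h2; rewrite -[(2 * _ * _)%N]mulnA -h2; lia.
  have pj : (0 < j.+1 ^ 2)%N by rewrite expn_gt0.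
  rewrite -(leq_pmul2l pj) mulnA -expnMn e1 expnMn.
  rewrite [(16 ^ _.+1)%N]expnS; move: IH; set x := ('C(_, _) ^ 2)%N; set y := (16 ^ j)%N => IH.
  have -> : (j.+1.*2.+1 = j.*2 + 3)%N by lia.
  (* After cancelling [4 (2j+1)] this is [(2j+1)(2j+3) <= (2j+2)^2]. *)
  have h : (j.*2.+1.*2 ^ 2 * (j.*2 + 3) <= (16 * j.+1 ^ 2) * j.*2.+1)%N by nia.
  rewrite mulnAC (leq_trans (leq_mul h (leqnn x)))//.
  rewrite -mulnA [(_ * x)%N]mulnC (leq_trans (leq_mul (leqnn _) IH))//.
  by rewrite [(16 * _ ^ _)%N]mulnC -mulnA.
have [j [->|->]] : exists j, n = j.*2 \/ n = j.*2.+1.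
  exists n./2; rewrite -{1 3}(odd_double_half n).
  by case: (odd n); [right|left].
- have -> : (j.*2 %/ 2 = j)%N by lia.
  have -> : (4 ^ j.*2 = 16 ^ j)%N by rewrite -mul2n expnM.
  by apply: leq_trans (ev j); rewrite leq_mul2l leqnSn orbT.
- have -> : (j.*2.+1 %/ 2 = j)%N by lia.
  have -> : (4 ^ j.*2.+1 = 4 * 16 ^ j)%N by rewrite expnS -mul2n expnM.
  have h : ('C(j.*2.+1, j) <= 2 * 'C(j.*2, j))%N.
    case: j => [//|j]; rewrite binS; have := bin_le_central j.+1.*2 j.
    have -> : (j.+1.*2 %/ 2 = j.+1)%N by lia.
    by lia.
  apply: (@leq_trans ((2 * 'C(j.*2, j)) ^ 2 * j.*2.+1)%N).
    by rewrite leq_mul2r leq_sqr h orbT.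
  by rewrite expnMn -mulnA leq_mul2l ev.
Qed.

Section set_pairs.
Variables (R : realFieldType) (I T : finType).
Implicit Types (P : pred I) (A B : I -> {set T}) (X : {set T}).

(** The probability that a random order of [a + b] points puts the [b] points of [B] before the [a]
    points of [A]. *)
Let weight (a b : nat) : R := ('C(a + b, a)%:R)^-1.

(** Condition on the first point drawn from a ground set of size [n]: outside both sets nothing
    changes, in [B] one point is removed, in [A] the event fails. *)
Let weight_step (n a b : nat) : (a + b <= n)%N -> (0 < b)%N ->
  (n - (a + b))%:R * weight a b + b%:R * weight a b.-1 = n%:R * weight a b.
Proof.
move=> abn b0; rewrite /weight natrB// mulrBl.
have := mul_bin_down (a + b) a; rewrite addKn.
have -> : ((a + b).-1 = a + b.-1)%N by lia.
move=> /(congr1 (fun m => m%:R : R)); rewrite !natrM => h.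
have c1 : ('C(a + b, a)%:R : R) != 0 by rewrite pnatr_eq0 -lt0n bin_gt0; lia.
have c2 : ('C(a + b.-1, a)%:R : R) != 0 by rewrite pnatr_eq0 -lt0n bin_gt0; lia.
have -> : b%:R / 'C(a + b.-1, a)%:R = (a + b)%:R / 'C(a + b, a)%:R :> R.
  by apply/eqP; rewrite eqr_div// h.
by rewrite subrK.
Qed.

(* Averaging over the elements x of the ground set: keep the pairs with x not
   in A i and delete x from their B i. *)
Lemma bollobas_sum P A B :
  (forall i, P i -> [disjoint A i & B i]) ->
  (forall i j, P i -> P j -> i != j -> ~~ [disjoint A i & B j]) ->
  \sum_(i | P i) ('C(#|A i| + #|B i|, #|A i|)%:R)^-1 <= 1 :> R.
Proof.
suff H n X : #|X| = n -> forall P B,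
  (forall i, P i -> (A i \subset X) && (B i \subset X)) ->
  (forall i, P i -> [disjoint A i & B i]) ->
  (forall i j, P i -> P j -> i != j -> ~~ [disjoint A i & B j]) ->
  \sum_(i | P i) weight #|A i| #|B i| <= 1.
  by apply: (H _ [set: T]%SET erefl) => i _; rewrite !finset.subsetT.
clear P B.
(* An empty [B j] is disjoint from every [A i], so [j] is then the only index. Otherwise every [B i]
   is nonempty, as [weight_step] requires. *)
have pos (P : pred I) (B : I -> {set T}) : (forall i, P i -> [disjoint A i & B i]) ->
    (forall i j, P i -> P j -> i != j -> ~~ [disjoint A i & B j]) ->
    ((forall i, P i -> (0 < #|B i|)%N) ->
      \sum_(i | P i) weight #|A i| #|B i| <= 1) ->
    \sum_(i | P i) weight #|A i| #|B i| <= 1.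
  move=> dis cross le1.
  have [/existsP[j /andP[Pj /eqP/finset.cards0_eq Bj]]|] :=
    boolP [exists j, P j && (#|B j| == 0)%N]; last first.
    rewrite negb_exists => /forallP B0; apply: le1 => i Pi.
    by have := B0 i; rewrite Pi lt0n.
  rewrite (big_pred1 j); first by rewrite /weight Bj cards0 addn0 binn invr1.
  move=> l; apply/idP/eqP => [Pl|->//]; apply/eqP/negPn/negP => lj.
  by have := cross _ _ Pl Pj lj; rewrite Bj -finset.setI_eq0 finset.setI0 eqxx.
elim: n X => [|n IH] X cX P B sX dis cross; apply: pos => // B0.
- rewrite big1 ?ler01// => i Pi.
  have /andP[_ /subset_leq_card] := sX _ Pi.
  by rewrite cX leqNgt B0.
- have X0 : (0 : R) < #|X|%:R by rewrite cX ltr0n.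
  rewrite -(ler_pM2l X0) mulr1 mulr_sumr.
  have -> : \sum_(i | P i) #|X|%:R * weight #|A i| #|B i| =
    \sum_(x in X) \sum_(i | P i && (x \notin A i)) weight #|A i| #|B i :\ x|.
    under [RHS]eq_bigr do rewrite big_mkcondr /=.
    rewrite exchange_big /=; apply: eq_bigr => l Pl.
    have /andP[sA sB] := sX _ Pl.
    have AB0 := dis _ Pl.
    have cAB : #|A l :|: B l| = (#|A l| + #|B l|)%N.
      by apply/eqP; rewrite (leq_card_setU (A l) (B l)).2.
    have sAB : A l :|: B l \subset X by rewrite finset.subUset sA.
    rewrite -(weight_step (b := #|B l|) (a := #|A l|)); first last.
    + exact: B0.
    + by rewrite -cAB subset_leq_card.
    rewrite (bigID (mem (B l))) /= addrC; congr (_ + _).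
      rewrite (bigID (mem (A l))) /= [X in X + _]big1 ?add0r; last first.
        by move=> x /andP[_ /= ->].
      have -> : (#|X| - (#|A l| + #|B l|) = #|X :\: (A l :|: B l)|)%N.
        by rewrite cardsD (finset.setIidPr sAB) cAB.
      rewrite -sum1_card natr_sum mulr_suml; apply: eq_big => x.
        by rewrite !inE negb_or; case: (x \in X); case: (x \in A l); case: (x \in B l).
      rewrite !inE negb_or => /andP[/andP[xA xB] _]; rewrite xA mul1r; congr weight.
      have -> : B l :\ x = B l; last by [].
      by apply/finset.setP => y; rewrite !inE; case: eqP => // ->; rewrite (negbTE xB).
    rewrite -[X in X%:R * _]sum1_card natr_sum mulr_suml; apply: eq_big => x.
      by apply/idP/andP => [xB|[]//]; rewrite (fintype.subsetP sB _ xB).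
    move=> xB; rewrite mul1r.
    have -> : x \notin A l by rewrite (disjointFl AB0 xB).
    by congr weight; rewrite (cardsD1 x (B l)) xB.
  rewrite -sumr_const ler_sum// => x xX.
  apply: (IH (X :\ x)).
  + by move: cX; rewrite (cardsD1 x X) xX => -[].
  + move=> l /andP[/sX/andP[sA sB] xA]; rewrite finset.subsetD1 sA xA /=.
    by rewrite finset.setSD.
  + move=> l /andP[Pl xA]; apply: disjointWr (dis _ Pl).
    exact: finset.subD1set.
  + move=> l m /andP[Pl xA] /andP[Pm _] lm.
    have := cross _ _ Pl Pm lm; apply: contra => d.
    rewrite -finset.setI_eq0; apply/eqP/finset.setP => y; rewrite !inE.
    have := finset.disjoint_setI0 d => /finset.setP/(_ y); rewrite !inE.
    by case: eqP => [->|//]; rewrite (negbTE xA).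
Qed.

Lemma bollobas_card P A B (q : nat) :
  (forall i, P i -> [disjoint A i & B i]) ->
  (forall i j, P i -> P j -> i != j -> ~~ [disjoint A i & B j]) ->
  (forall i, P i -> #|A i| + #|B i| <= q)%N ->
  (#|P| <= 'C(q, q %/ 2))%N.
Proof.
move=> dis cross szq; have := bollobas_sum dis cross.
have c0 : (0 : R) < 'C(q, q %/ 2)%:R by rewrite ltr0n bin_gt0; lia.
rewrite -(ler_nat R) => h; rewrite -[leRHS]mulr1 -ler_pdivrMl//.
apply: le_trans h; rewrite -sum1_card natr_sum mulr_sumr.
apply: ler_sum => i Pi; rewrite mulr1 lef_pV2 ?posrE// ?ltr0n ?bin_gt0 ?leq_addr//.
rewrite ler_nat; apply: leq_trans (bin_le_central _ _) _.
exact/bin_central_monotone/szq.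
Qed.

End set_pairs.

(** * Oracle algorithms and their query traces *)

Definition qpoint : countType := {l : nat & l.-tuple bool}.

Fixpoint trace (O : oracle) (A : Type) (p : oalg A) : seq qpoint :=
  match p with
  | Return _ => [::]
  | Query l x k => Tagged _ x :: trace O (k (O l x))
  end.

Fixpoint oalg_bind (A B : Type) (p : oalg A) (f : A -> oalg B) : oalg B :=
  match p with
  | Return a => f a
  | Query l x k => Query x (fun y => oalg_bind (k y) f)
  end.

(** Lets the adversary see which points a simulated verification asks. *)
Fixpoint logged (A : Type) (p : oalg A) : oalg (A * seq qpoint) :=
  match p with
  | Return a => Return (a, [::])
  | Query l x k => Query x (fun y =>
      oalg_bind (logged (k y)) (fun r => Return (r.1, (Tagged _ x : qpoint) :: r.2)))
  end.

Definition patch_oracle (T : pred qpoint) (O1 O : oracle) : oracle :=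
  fun l x => if T (Tagged _ x) then O1 l x else O l x.

(** The simulation of [patch_oracle T O1 O] by a program with access to [O] only; points of [T] cost
    no query. *)
Fixpoint patched (T : pred qpoint) (O1 : oracle) (A : Type) (p : oalg A) : oalg A :=
  match p with
  | Return a => Return a
  | Query l x k =>
    if T (Tagged _ x) then patched T O1 (k (O1 l x))
    else Query x (fun y => patched T O1 (k y))
  end.

Definition agree (D : pred qpoint) (O1 O2 : oracle) : Prop :=
  forall l (x : l.-tuple bool), D (Tagged _ x) -> O1 l x = O2 l x.

Definition agree_below (L : nat) : oracle -> oracle -> Prop :=
  agree (fun x : qpoint => tag x < L)%N.

Section oalg_theory.
Variables (A B : Type).
Implicit Types (p : oalg A) (O : oracle).

Lemma nqueries_trace O p : nqueries O p = size (trace O p).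
Proof. by elim: p => //= l x k IH; rewrite IH. Qed.

Lemma agree_run (D : pred qpoint) O O' p :
  {subset trace O p <= D} -> agree D O O' ->
  run O' p = run O p /\ trace O' p = trace O p.
Proof.
move=> + OO'; elim: p => //= l x k IH sD.
have <- : O l x = O' l x by apply: OO'; apply: sD; rewrite mem_head.
have [|-> ->//] := IH (O l x).
by move=> y yk; apply: sD; rewrite in_cons yk orbT.
Qed.

Lemma run_bind O p (f : A -> oalg B) : run O (oalg_bind p f) = run O (f (run O p)).
Proof. by elim: p => //= l x k IH; rewrite IH. Qed.

Lemma trace_bind O p (f : A -> oalg B) :
  trace O (oalg_bind p f) = trace O p ++ trace O (f (run O p)).
Proof. by elim: p => //= l x k IH; rewrite IH. Qed.

Lemma run_patched T O1 O p : run O (patched T O1 p) = run (patch_oracle T O1 O) p.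
Proof.
by elim: p => //= l x k IH; rewrite /patch_oracle; case: ifP => /= _; rewrite IH.
Qed.

Lemma nqueries_patched T O1 O p :
  (nqueries O (patched T O1 p) <= nqueries (patch_oracle T O1 O) p)%N.
Proof.
elim: p => //= l x k IH; rewrite {2}/patch_oracle; case: ifP => /= _; last exact: IH.
exact: leqW.
Qed.

(* Either every query is in K, or a first query outside K is asked, and it is
   determined by the answers on K. *)
Lemma trace_first_outside (K : pred qpoint) O p :
  {subset trace O p <= K} \/
  exists2 x, ~~ K x & forall O', agree K O O' -> x \in trace O' p.
Proof.
elim: p => [a|l x k IH] /=; first by left.
have [Kx|nKx] := boolP (K (Tagged _ x)); last first.
  by right; exists (Tagged _ x) => // O' _; rewrite mem_head.
case: (IH (O l x)) => [h|[y nKy h]].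
  by left=> y; rewrite in_cons => /predU1P[->//|/h].
right; exists y => // O' OO'.
by rewrite in_cons -(OO' l x Kx) h ?orbT.
Qed.

Lemma trace_level_bounded p :
  exists L, forall O x, x \in trace O p -> (tag x < L)%N.
Proof.
elim: p => [a|l x k /choice[f IH]]; first by exists 0%N.
exists (maxn l.+1 (\max_y f y)) => O y /=; rewrite in_cons => /predU1P[->/=|].
  by rewrite leq_max leqnn.
move=> /IH h; rewrite leq_max; apply/orP; right.
exact: leq_trans h (leq_bigmax _).
Qed.

End oalg_theory.

Lemma run_logged (A : Type) O (p : oalg A) :
  run O (logged p) = (run O p, trace O p).
Proof. by elim: p => //= l x k IH; rewrite run_bind IH. Qed.

Lemma trace_logged (A : Type) O (p : oalg A) : trace O (logged p) = trace O p.
Proof.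
by elim: p => //= l x k IH; rewrite trace_bind IH /= cats0.
Qed.

Fixpoint collect (I A : Type) (s : seq I) (p : I -> oalg A) : oalg (seq (I * A)) :=
  if s is i :: s' then
    oalg_bind (p i) (fun a => oalg_bind (collect s' p) (fun r => Return ((i, a) :: r)))
  else Return [::].

Lemma run_collect (I A : Type) O (s : seq I) (p : I -> oalg A) :
  run O (collect s p) = [seq (i, run O (p i)) | i <- s].
Proof. by elim: s => //= i s IH; rewrite !run_bind IH. Qed.

Lemma trace_collect (I A : Type) O (s : seq I) (p : I -> oalg A) :
  trace O (collect s p) = flatten [seq trace O (p i) | i <- s].
Proof. by elim: s => //= i s IH; rewrite !trace_bind IH /= cats0. Qed.

(** * Oracles cut off at a finite length *)

Definition finite_oracle (L : nat) : finType :=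
  {dffun forall l : 'I_L, {ffun l.-tuple bool -> l.-tuple bool}}.

(* Strings of length at least [L] are answered by themselves. *)
Definition ev (L : nat) (a : finite_oracle L) : oracle :=
  fun l => match @idP (l < L)%N with
           | ReflectT h => a (Ordinal h)
           | ReflectF _ => fun x => x
           end.

Definition truncate (L : nat) (O : oracle) : finite_oracle L :=
  [ffun l : 'I_L => finfun (O l)].

Lemma ev_truncate L O : agree_below L (ev (truncate L O)) O.
Proof.
by move=> l x /= lL; rewrite /ev; case: {-}_ / idP => // h; rewrite !ffunE.
Qed.

Lemma agree_below_truncate L O O' :
  agree_below L O O' -> truncate L O = truncate L O'.
Proof.
move=> OO'; apply/ffunP => l; rewrite !ffunE; apply/ffunP => x.
by rewrite !ffunE; apply: OO' => /=.
Qed.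

Lemma truncate_ev L (a : finite_oracle L) : truncate L (ev a) = a.
Proof.
apply/ffunP => -[l lL]; rewrite ffunE; apply/ffunP => x; rewrite ffunE /ev /=.
by case: {-}_ / idP => // h; rewrite (bool_irrelevance h lL).
Qed.

Lemma ev_out L (a : finite_oracle L) l (x : l.-tuple bool) :
  (L <= l)%N -> ev a x = x.
Proof. by move=> Ll; rewrite /ev; case: {-}_ / idP => // h; lia. Qed.

Definition mix (L : nat) (T : pred qpoint) (a b : finite_oracle L) : finite_oracle L :=
  truncate L (patch_oracle T (ev a) (ev b)).

(** No bound on the length is needed: long strings are answered by themselves in both oracles. *)
Lemma ev_mix L T (a b : finite_oracle L) l (x : l.-tuple bool) :
  ev (mix T a b) x = if T (Tagged _ x) then ev a x else ev b x.
Proof.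
have [lL|Ll] := ltnP l L; first by rewrite ev_truncate.
by rewrite !ev_out// if_same.
Qed.

(** * The attack on a finite set of worlds *)

Section attack.
Variables (R : realType) (M : Type) (S : scheme R M) (q : nat).
Hypotheses (complete : perfectly_complete S) (total : total_queries_le S q).
Variables (k : nat) (msg : 'I_k -> M).
Hypothesis msg_inj : injective msg.
Variables (G : finType) (coin : G -> outcome (gen_coins S)).
Hypothesis coin_gt0 : forall g, 0 < Defs.pmf (coin g).

Definition keys (O : oracle) (g : G) := run O (gen (coin g)).
Definition honest_sig (O : oracle) (g : G) (i : 'I_k) :=
  run O (sign (keys O g).1 (msg i)).
Definition gs_trace (O : oracle) (g : G) (i : 'I_k) : seq qpoint :=
  trace O (gen (coin g)) ++ trace O (sign (keys O g).1 (msg i)).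
Definition ver_trace (O : oracle) (g : G) (i : 'I_k) : seq qpoint :=
  trace O (ver (keys O g).2 (msg i) (honest_sig O g i)).
Definition all_trace (O : oracle) (g : G) : seq qpoint :=
  flatten [seq gs_trace O g i ++ ver_trace O g i | i <- enum 'I_k].

Lemma honest_trace_size O g i :
  (size (gs_trace O g i) + size (ver_trace O g i) <= q)%N.
Proof.
have := total O (coin_gt0 g) (msg i); rewrite /gs_trace /ver_trace /honest_sig /keys.
by case: (run O (gen (coin g))) => sk vk /=; rewrite !nqueries_trace size_cat.
Qed.

Lemma honest_accepts O g i :
  run O (ver (keys O g).2 (msg i) (honest_sig O g i)) = true.
Proof.
have := complete O (coin_gt0 g) (msg i); rewrite /honest_sig /keys.
by case: (run O (gen (coin g))) => sk vk.
Qed.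

Lemma all_traceP O g x :
  reflect (exists i, (x \in gs_trace O g i) || (x \in ver_trace O g i))
    (x \in all_trace O g).
Proof.
apply: (iffP flatten_mapP) => [[i _]|[i h]]; first by rewrite mem_cat; exists i.
by exists i; rewrite ?mem_enum// mem_cat.
Qed.

Lemma all_trace_size O g : (size (all_trace O g) <= q * k)%N.
Proof.
rewrite size_flatten /shape -map_comp sumnE big_map big_enum /=.
apply: (@leq_trans (\sum_(i < k) q)); last by rewrite sum_nat_const card_ord mulnC.
by apply: leq_sum => i _ /=; rewrite size_cat honest_trace_size.
Qed.

Lemma agree_gs O O' g i : agree (mem (gs_trace O g i)) O O' ->
  [/\ keys O' g = keys O g, honest_sig O' g i = honest_sig O g i &
      gs_trace O' g i = gs_trace O g i].
Proof.
move=> OO'.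
have [|ek et] := agree_run (p := gen (coin g)) _ OO'.
  by move=> x xt; rewrite /= inE mem_cat xt.
have [|es es'] := agree_run (p := sign (keys O g).1 (msg i)) _ OO'.
  by move=> x xt; rewrite /= inE mem_cat xt orbT.
have e : keys O' g = keys O g by [].
by rewrite /honest_sig /gs_trace e et es es'.
Qed.

Lemma agree_all O O' g : agree (mem (all_trace O g)) O O' -> forall i,
  [/\ keys O' g = keys O g, honest_sig O' g i = honest_sig O g i,
      gs_trace O' g i = gs_trace O g i & ver_trace O' g i = ver_trace O g i].
Proof.
move=> OO' i.
have [|e1 e2 e3] := agree_gs (O := O) (O' := O') (g := g) (i := i).
  by move=> l x /= h; apply: OO' => /=; apply/all_traceP; exists i; rewrite h.
split => //; rewrite /ver_trace e1 e2.
have [|//] := agree_run (p := ver (keys O g).2 (msg i) (honest_sig O g i)) _ OO'.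
by move=> x xt; apply/all_traceP; exists i; rewrite xt orbT.
Qed.

Variable L : nat.
Hypothesis bounded : forall O g x, x \in all_trace O g -> (tag x < L)%N.

(** * Finite worlds and the sets of worlds consistent with a view *)

Definition world : finType := (finite_oracle L * G)%type.
Implicit Types (w : world) (W : pred world) (K : seq qpoint).

(* Unnormalised: every oracle in [finite_oracle L] has weight 1. *)
Definition mass W : R := \sum_(w | W w) Defs.pmf (coin w.2).

Lemma mass_ge0 W : 0 <= mass W.
Proof. by apply: sumr_ge0 => w _; apply: ltW. Qed.

Lemma mass_le W W' : (forall w, W w -> W' w) -> mass W <= mass W'.
Proof.
move=> WW'; rewrite /mass [leRHS](bigID W) /= -[leLHS]addr0.
rewrite lerD ?sumr_ge0// => [|w _]; last exact: ltW.
rewrite le_eqVlt; apply/orP; left; apply/eqP; apply: eq_bigl => w.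
by case Ww : (W w); rewrite ?andbF// WW'.
Qed.

Lemma massU W W' W'' : (forall w, W w -> W' w || W'' w) ->
  mass W <= mass W' + mass W''.
Proof.
move=> h; rewrite /mass [leLHS](bigID W') /= lerD//; apply: mass_le => w.
  by case/andP.
by case/andP => /h; case: (W' w).
Qed.

(* From a signature on [msg i] the attack can forge none of the other messages. *)
Definition bad w (i : 'I_k) : bool :=
  [forall j, (j != i) ==> has (fun x => (x \in gs_trace (ev w.1) w.2 i) &&
     (x \notin ver_trace (ev w.1) w.2 i)) (ver_trace (ev w.1) w.2 j)].

Lemma card_bad w : (#|bad w| <= 'C(q, q %/ 2))%N.
Proof.
(* The points asked in this one world form the finite ground set of the set pairs. *)
pose X := all_trace (ev w.1) w.2.
pose Gt := gs_trace (ev w.1) w.2; pose Vt := ver_trace (ev w.1) w.2.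
pose A i := finset (fun t : seq_sub X => (ssval t \in Gt i) && (ssval t \notin Vt i)).
pose B i := finset (fun t : seq_sub X => ssval t \in Vt i).
have card_sub (s : seq qpoint) (D : {set seq_sub X}) :
    (forall t, t \in D -> ssval t \in s) -> (#|D| <= size s)%N.
  move=> Ds; rewrite cardE -(size_map val); apply: uniq_leq_size.
    by rewrite map_inj_uniq ?enum_uniq//; exact: val_inj.
  by move=> x /mapP[t]; rewrite mem_enum => /Ds ? ->.
apply: (@bollobas_card R _ _ (bad w) A B).
- move=> i _; apply/pred0P => t /=; rewrite !finset.in_set.
  by case: (_ \in Vt i); rewrite ?andbF.
- move=> i j /forallP/(_ j)/implyP + _ ij.
  rewrite eq_sym => /(_ ij)/hasP[x xj /andP[xi1 xi2]].
  have xX : x \in X by apply/all_traceP; exists i; rewrite xi1.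
  apply/pred0Pn; exists (SeqSub xX) => /=; rewrite !finset.in_set /=.
  by rewrite xi1 xi2 xj.
- move=> i _; apply: leq_trans (honest_trace_size (ev w.1) w.2 i).
  apply: leq_add; apply: card_sub => t; rewrite finset.in_set//.
  by case/andP.
Qed.

Variables (alpha : 'I_k) (eps : R).
Hypotheses (eps_gt0 : 0 < eps) (eps_le1 : eps <= 1).

Definition gs w := gs_trace (ev w.1) w.2 alpha.
Definition Q w := all_trace (ev w.1) w.2.
Definition view w := ((keys (ev w.1) w.2).2, honest_sig (ev w.1) w.2 alpha).

(** This is [bad] for [alpha] with the known points [K] in place of the trace of Ver(alpha); it
    implies [bad] once [K] contains that trace. *)
Definition unsafe K w : bool :=
  [forall j, (j != alpha) ==> has (fun x => (x \in gs w) && (x \notin K))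
     (ver_trace (ev w.1) w.2 j)].

(** Membership in [W] depends only on the coins and on the answers on [gs] and [K], which is why
    [swap] does not leave [W]. *)
Definition closed W K := forall (a a' : finite_oracle L) g, W (a, g) ->
  agree (fun x => (x \in gs (a, g)) || (x \in K)) (ev a) (ev a') -> W (a', g).

Definition coherent W K := forall w w', W w -> W w' ->
  view w = view w' /\ agree (mem K) (ev w.1) (ev w'.1).

(* Stated for every oracle extending the finite one, so that winning is an event
   decided by the answers to strings of length below [L]. *)
Definition wins w (p : oalg (M * signature S)) : Prop :=
  forall O, agree_below L (ev w.1) O ->
    (run O p).1 <> msg alpha /\
    run O (ver (view w).1 (run O p).1 (run O p).2) = true.

(* The imagined world [w'] on the queries of Gen and Sign(alpha), the real world
   [w] elsewhere. *)
Definition hybrid w' w : world := (mix (mem (gs w')) w'.1 w.1, w'.2).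

(** The program signs with the imagined key under the patched oracle and outputs a message whose
    verification meets [gs w'] only inside [K]. There the real oracle agrees by coherence, so it
    repeats the accepting verification. *)
Lemma forge_from_fake W K w' (d : M * signature S) : coherent W K -> W w' ->
  exists p : oalg (M * signature S), (forall O, nqueries O p <= q * k)%N /\
    forall w, W w -> ~~ unsafe K (hybrid w' w) -> wins w p.
Proof.
move=> coh Ww'; pose g := w'.2; pose O' := ev w'.1.
pose kp := keys O' g.
pose prog i := oalg_bind (sign kp.1 (msg i)) (fun s =>
  oalg_bind (logged (ver kp.2 (msg i) s)) (fun r => Return (s, r.2))).
pose ok (e : 'I_k * (signature S * seq qpoint)) :=
  (e.1 != alpha) && all (fun x => (x \in gs w') ==> (x \in K)) e.2.2.
(* The default [d] is returned only if no message passes the test, which cannot happen when the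
   hybrid is not [unsafe]. *)
pose out r := if ohead [seq e <- r | ok e] is Some e then (msg e.1, e.2.1) else d.
exists (oalg_bind (patched (mem (gs w')) O' (collect (enum 'I_k) prog))
  (fun r => Return (out r))).
have pO O : [/\ keys (patch_oracle (mem (gs w')) O' O) g = kp,
    honest_sig (patch_oracle (mem (gs w')) O' O) g alpha = honest_sig O' g alpha &
    gs_trace (patch_oracle (mem (gs w')) O' O) g alpha = gs w'].
  by apply: agree_gs => l x /= h; rewrite /patch_oracle /= /gs h.
have run_prog O i : keys O g = kp ->
    run O (prog i) = (honest_sig O g i, ver_trace O g i).
  by move=> e; rewrite /prog !run_bind run_logged /= /honest_sig /ver_trace /honest_sig e.
have trace_prog O i : keys O g = kp -> (size (trace O (prog i)) <= q)%N.
  move=> e; rewrite /prog !trace_bind trace_logged /= cats0.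
  apply: leq_trans (honest_trace_size O g i).
  by rewrite /gs_trace /ver_trace /honest_sig e !size_cat -addnA leq_addl.
split=> [ O | w Ww].
  rewrite nqueries_trace trace_bind /= cats0 -nqueries_trace.
  apply: leq_trans (nqueries_patched _ _ _ _) _.
  have [ek _ _] := pO O; move: ek; set P := patch_oracle _ _ _ => ek.
  rewrite nqueries_trace trace_collect.
  rewrite size_flatten /shape -map_comp sumnE big_map big_enum /=.
  apply: (@leq_trans (\sum_(i < k) q)); last by rewrite sum_nat_const card_ord mulnC.
  by apply: leq_sum => i _ /=; apply: trace_prog.
rewrite negb_forall => /existsP[j]; rewrite negb_imply => /andP[ja safe] O wO.
have [ek es et] := pO O; move: ek es et; set P := patch_oracle _ _ _ => ek es et.
have hP : agree_below L (ev (hybrid w' w).1) P.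
  move=> l x /= lL; rewrite ev_mix /P /patch_oracle; case: ifP => // _.
  exact: wO.
have hQ : agree (mem (all_trace (ev (hybrid w' w).1) g)) (ev (hybrid w' w).1) P.
  by move=> l x h; apply: hP => /=; exact: (bounded h).
have [_ _ _ ev_j] := agree_all hQ j.
have [_ _ et' _] := agree_all hQ alpha.
have runp : run O (oalg_bind (patched (mem (gs w')) O' (collect (enum 'I_k) prog))
  (fun r => Return (out r))) = out [seq (i, (honest_sig P g i, ver_trace P g i)) | i <- enum 'I_k].
  rewrite run_bind run_patched /= run_collect; congr out.
  by apply: eq_map => i; rewrite run_prog.
rewrite runp /out filter_map.
set s := [seq i <- _ | _].
have js : j \in s.
  rewrite mem_filter mem_enum andbT /= /ok /= ja /=; apply/allP => x.
  rewrite ev_j => xj; apply/implyP => xg; apply: contraNT safe => xK.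
  by apply/hasP; exists x => //; rewrite xK andbT /gs -et' et.
(* The message [i] found first may differ from [j]; passing the test is all that is used of it. *)
have [i is_] : exists i, ohead s = Some i by case: (s) js => // i s' _; exists i.
have : i \in s by move: is_; case: (s) => // i' s' [->]; rewrite mem_head.
have -> : ohead [seq (i0, (honest_sig P g i0, ver_trace P g i0)) | i0 <- s] =
    Some (i, (honest_sig P g i, ver_trace P g i)).
  by move: is_; case: (s) => // i' s' [->].
rewrite mem_filter /= /ok /= => /andP[/andP[ia /allP iK] _].
split; first by move/msg_inj => e; rewrite e eqxx in ia.
(* Perfect completeness is applied to the patched oracle [P], for which the imagined keys are
   honestly generated. *)
rewrite -(honest_accepts P g i).
have [ev_ eK] := coh _ _ Ww Ww'.
have evk : (keys (ev w.1) w.2).2 = (keys P g).2 by rewrite ek; exact: (congr1 fst ev_).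
rewrite /view /= evk.
apply: (proj1 (agree_run (D := mem (ver_trace P g i)) _ _)) => // l x /= xi.
rewrite /P /patch_oracle; case: ifP => //= xg.
have xK : Tagged _ x \in K by have := iK _ xi; rewrite xg.
apply: etrans (esym (eK l x xK)) _; apply: wO => /=.
have := bounded (O := P) (g := g) (x := Tagged _ x); apply.
by apply/all_traceP; exists i; rewrite xi orbT.
Qed.

(* The points of [gs] keep their answers, so [swap] changes neither trace and is
   an involution. *)
Definition swap (u : world * world) : world * world :=
  let U := fun x => (x \in gs u.1) || (x \in gs u.2) in
  ((mix U u.1.1 u.2.1, u.1.2), (mix U u.2.1 u.1.1, u.2.2)).

Lemma gs_swap u : gs (swap u).1 = gs u.1 /\ gs (swap u).2 = gs u.2.
Proof.
split; rewrite /gs /swap /=.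
  have [//|_ _ ->//] := agree_gs (O := ev u.1.1) (g := u.1.2) (i := alpha)
    (O' := ev (swap u).1.1).
  by move=> l x /= h; rewrite ev_mix /gs h.
have [//|_ _ ->//] := agree_gs (O := ev u.2.1) (g := u.2.2) (i := alpha)
  (O' := ev (swap u).2.1).
by move=> l x /= h; rewrite ev_mix /gs h orbT.
Qed.

Lemma swapK : involutive swap.
Proof.
move=> u; have [e1 e2] := gs_swap u.
case: u e1 e2 => -[a g] [b h] e1 e2.
rewrite {1}/swap e1 e2 /=; congr (_, _); congr (_, _).
  rewrite -[RHS]truncate_ev; apply: agree_below_truncate => l x _.
  by rewrite /patch_oracle !ev_mix; case: (_ || _).
rewrite -[RHS]truncate_ev; apply: agree_below_truncate => l x _.
by rewrite /patch_oracle !ev_mix; case: (_ || _).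
Qed.

Lemma swap_closed W K u : coherent W K -> closed W K ->
  W u.1 -> W u.2 -> W (swap u).1 /\ W (swap u).2.
Proof.
move=> coh cl; case: u => -[a g] [b h] /= W1 W2.
have [_ ab] := coh _ _ W1 W2.
split; [apply: (cl a) => // l x|apply: (cl b) => // l x]; rewrite ev_mix /=.
  by case/orP => [->//|xK]; rewrite (ab _ _ xK) if_same.
by case/orP => [->|xK]; rewrite ?orbT// -(ab _ _ xK) if_same.
Qed.

Definition hits K w w' : bool := has (fun x => (x \in gs w) && (x \notin K)) (Q w').

(** The hybrid and the second swapped world can differ only on [gs w] outside [gs w']. On [K] the
    two original oracles agree, and off [K] such a point is not asked unless [hits] holds; so all
    honest traces coincide. *)
Lemma unsafe_hybrid W K w w' : coherent W K -> W w -> W w' ->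
  unsafe K (hybrid w' w) ->
  unsafe K (swap (w, w')).2 || hits K (swap (w, w')).1 (swap (w, w')).2.
Proof.
move=> coh Ww Ww' uns.
have [//|nohit] := boolP (hits _ _ _); first by rewrite orbT.
have [_ ab] := coh _ _ Ww Ww'.
have [g1 g2] := gs_swap (w, w'); rewrite /= in g1 g2.
have hA : agree (mem (Q (swap (w, w')).2)) (ev (swap (w, w')).2.1)
    (ev (hybrid w' w).1).
  move=> l x /= xQ; rewrite !ev_mix /=.
  have [//|xw'] := boolP (_ \in gs w'); first by rewrite orbT.
  rewrite orbF; case: ifP => // xw; apply/esym/ab => /=.
  apply: contraNT nohit => xK; apply/hasP; exists (Tagged _ x) => //.
  by rewrite g1 xw xK.
rewrite orbF; apply/forallP => j; have /forallP/(_ j) := uns.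
have [_ _ _ <-] := agree_all hA j.
have [_ _ + _] := agree_all hA alpha.
by rewrite /gs => <-.
Qed.

Definition heavy W K x :=
  x \notin K /\ eps * mass W <= mass (fun w => W w && (x \in Q w)).

(** Average over [w'] with the weights of its coins. Reindexing pairs by [swap], which keeps both
    coins and the set [W], turns the hybrid into an honest world of [W], up to the event [hits]. *)
Lemma exists_fake W K w0 : coherent W K -> closed W K -> W w0 ->
  (forall x, ~ heavy W K x) ->
  exists2 w', W w' & mass (fun w => W w && unsafe K (hybrid w' w)) <=
    mass (fun w => W w && unsafe K w) + q%:R * eps * mass W.
Proof.
move=> coh cl Ww0 light; apply: contrapT => no.
pose mu w := Defs.pmf (coin w.2).
have mu_gt0 w : 0 < mu w by exact: coin_gt0.
pose c := mass (fun w => W w && unsafe K w) + q%:R * eps * mass W.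
have massE P : mass (fun w => W w && P w) = \sum_(w | W w) mu w * (P w)%:R.
  rewrite /mass big_mkcondr; apply: eq_bigr => w _.
  by case: (P w); rewrite ?mulr1 ?mulr0.
have : \sum_(w' | W w') mu w' * c <
   \sum_(w' | W w') mu w' * mass (fun w => W w && unsafe K (hybrid w' w)).
  apply: ltr_sum; last first.
    move=> w' Ww'; rewrite ltr_pM2l; last exact: mu_gt0.
    by rewrite ltNge; apply/negP => h; apply: no; exists w'.
  by apply/hasP; exists w0; rewrite ?mem_index_enum.
apply/negP; rewrite -leNgt -mulr_suml.
under eq_bigr => w' _ do rewrite massE mulr_sumr.
pose F (u : world * world) : R := (unsafe K u.2)%:R + (hits K u.1 u.2)%:R.
have step1 : \sum_(w' | W w') \sum_(w | W w) mu w' * (mu w * (unsafe K (hybrid w' w))%:R)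
   <= \sum_(w' | W w') \sum_(w | W w) mu w * mu w' * F (swap (w, w')).
  apply: ler_sum => w' Ww'; apply: ler_sum => w Ww.
  rewrite mulrA [mu w' * _]mulrC ler_wpM2l ?mulr_ge0//; [exact: ltW|exact: ltW|].
  have := unsafe_hybrid coh Ww Ww'; rewrite /F.
  case: (unsafe K (hybrid _ _)) => [/(_ isT)|_]; last by rewrite addr_ge0.
  by case: (unsafe K _); case: (hits K _ _) => //= _; rewrite ?addr0 ?add0r ?lerDl.
apply: le_trans step1 _.
rewrite exchange_big pair_big /=.
rewrite (reindex_inj (inv_inj swapK)) /=.
have -> : \sum_(u | W (swap u).1 && W (swap u).2)
    mu (swap u).1 * mu (swap u).2 * F (swap ((swap u).1, (swap u).2)) =
  \sum_(u | W u.1 && W u.2) mu u.1 * mu u.2 * F u.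
  apply: eq_big => u; last first.
    by move=> _; rewrite -surjective_pairing swapK.
  apply/idP/idP => /andP[h1 h2].
    by have [] := swap_closed coh cl h1 h2; rewrite swapK => -> ->.
  by have [-> ->] := swap_closed coh cl h1 h2.
rewrite -(pair_big _ _ (fun w w' => mu w * mu w' * F (w, w'))) /=.
rewrite mulr_suml; apply: ler_sum => w Ww.
under eq_bigr => w' _ do rewrite -mulrA.
rewrite -mulr_sumr ler_wpM2l//; first exact: ltW.
under eq_bigr => w' _ do rewrite /F /= mulrDr.
rewrite big_split /= -massE /c lerD2l -massE.
have := honest_trace_size (ev w.1) w.2 alpha => /(leq_trans (leq_addr _ _)).
rewrite -/(gs w) => sz.
(* Union bound over the at most [q] points of [gs w]: those in [K] do not count, and each other one
   is light. *)
have : mass (fun w' => W w' && hits K w w') <= (size (gs w))%:R * (eps * mass W).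
  rewrite /hits; elim: (gs w) => [|x s IH].
    rewrite mul0r /mass big_pred0// => w'.
    by rewrite (eq_has (a2 := pred0)) ?has_pred0 ?andbF.
  rewrite -natr1 mulrDl mul1r.
  apply: le_trans (massU (W' := fun w' => W w' && has (fun x => (x \in s) && (x \notin K)) (Q w'))
    (W'' := fun w' => W w' && ((x \in Q w') && (x \notin K))) _) _.
    move=> w' /andP[-> /= /hasP[y yQ /andP[]]]; rewrite in_cons.
    case/predU1P => [<- -> |ys yK]; first by rewrite yQ orbT.
    by apply/orP; left; apply/hasP; exists y => //; rewrite ys.
  rewrite lerD//.
  have [xK|xK] := boolP (x \in K).
    by rewrite /mass big_pred0 ?mulr_ge0 ?mass_ge0 ?ltW// => w'; rewrite !andbF.
  rewrite leNgt; apply/negP => h; apply: (light x); split => //.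
  by apply: le_trans (ltW h) _; apply: mass_le => w'; case/and3P => -> ->.
move=> /le_trans; apply; rewrite -mulrA ler_wpM2r ?ler_nat// mulr_ge0 ?mass_ge0//.
exact: ltW.
Qed.

(* The first query of Ver(alpha) outside [K] is the same in all worlds of [W],
   hence heavy. *)
Lemma ver_known W K : coherent W K -> (forall x, ~ heavy W K x) ->
  forall w, W w -> {subset ver_trace (ev w.1) w.2 alpha <= mem K}.
Proof.
move=> coh light w Ww.
have [//|[x xK h]] := trace_first_outside (mem K) (ev w.1)
  (ver (view w).1 (msg alpha) (view w).2).
exfalso; apply: (light x); split => //.
apply: (@le_trans _ _ (mass W)); first by rewrite ler_piMl ?mass_ge0.
apply: mass_le => w' Ww'; rewrite Ww'; apply/all_traceP; exists alpha.
by have [e /h] := coh _ _ Ww Ww'; rewrite e => ->; rewrite orbT.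
Qed.

(** * Learning the heavy points *)

Definition fresh K w : nat := size (undup [seq x <- Q w | x \notin K]).

Lemma fresh_cons K x w :
  x \notin K -> ((x \in Q w) + fresh (x :: K) w <= fresh K w)%N.
Proof.
move=> xK; have [xQ|xQ] := boolP (x \in Q w); rewrite /= ?add1n ?add0n.
  rewrite -[X in (X <= _)%N]/(size (x :: undup [seq y <- Q w | y \notin x :: K])).
  apply: uniq_leq_size.
    by rewrite /= undup_uniq mem_undup mem_filter mem_head.
  move=> y; rewrite in_cons => /predU1P[->|]; rewrite !mem_undup !mem_filter ?xK//.
  by rewrite in_cons negb_or => /andP[/andP[_ ->] ->].
apply: uniq_leq_size; first exact: undup_uniq.
move=> y; rewrite !mem_undup !mem_filter in_cons negb_or.
by case/andP => /andP[_ ->] ->.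
Qed.

Definition potential W K : R :=
  \sum_(w | W w) Defs.pmf (coin w.2) * (fresh K w)%:R.

Lemma potential_ge0 W K : 0 <= potential W K.
Proof. by apply: sumr_ge0 => w _; rewrite mulr_ge0// ltW. Qed.

Lemma potential_heavy W K x : heavy W K x ->
  eps * mass W + potential W (x :: K) <= potential W K.
Proof.
move=> [xK hx]; apply: le_trans (lerD hx (lexx _)) _.
rewrite /mass big_mkcondr -big_split /=; apply: ler_sum => w Ww.
apply: (@le_trans _ _ (Defs.pmf (coin w.2) * ((x \in Q w) + fresh (x :: K) w)%:R)).
  by rewrite natrD mulrDr lerD2r; case: ifP; rewrite ?mulr1 ?mulr0.
by rewrite ler_wpM2l ?(ltW (coin_gt0 _))// ler_nat fresh_cons.
Qed.

Definition loss W (p : oalg (M * signature S)) : R :=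
  mass (fun w => W w && ~~ `[< wins w p >]).

Lemma loss_le_mass W p : loss W p <= mass W.
Proof. by apply: mass_le => w /andP[]. Qed.

(** The loss not explained by bad worlds or by light hits. It is at most 0 once no heavy point is
    left, so only stopping the learning too early makes it positive. *)
Definition excess W p : R :=
  loss W p - mass (fun w => W w && bad w alpha) - q%:R * eps * mass W.

Lemma excess_le_mass W p : excess W p <= mass W.
Proof.
have q0 : 0 <= q%:R * eps * mass W by rewrite !mulr_ge0 ?mass_ge0 ?(ltW eps_gt0).
have := loss_le_mass W p; have := mass_ge0 (fun w => W w && bad w alpha).
rewrite /excess; lra.
Qed.

Lemma forge_light W K w0 (d : M * signature S) :
  coherent W K -> closed W K -> W w0 -> (forall x, ~ heavy W K x) ->
  exists p : oalg (M * signature S),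
    (forall O, nqueries O p <= q * k)%N /\ excess W p <= 0.
Proof.
move=> coh cl Ww0 light; have [w' Ww' hw'] := exists_fake coh cl Ww0 light.
have [p [np pw]] := forge_from_fake d coh Ww'; exists p; split => //.
rewrite /excess -addrA -opprD subr_le0.
apply: le_trans (le_trans _ hw') _.
  apply: mass_le => w /andP[Ww]; rewrite Ww; apply: contraNT => uns.
  exact/asboolP/pw.
rewrite lerD2r; apply: mass_le => w /andP[Ww /forallP uns]; rewrite Ww.
apply/forallP => j; apply/implyP => ja; have /implyP/(_ ja)/hasP[x xj] := uns j.
case/andP => xg xK; apply/hasP; exists x => //; rewrite [X in X && _]xg /=.
by apply: contra xK; exact: ver_known coh light _ Ww _.
Qed.

(* The sum of [fresh] over the consistent worlds is a potential: asking a heavy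
   point lowers it by at least [eps] times their mass. *)
Lemma learn (B : nat) (d : M * signature S) W K : coherent W K -> closed W K ->
  exists p : oalg (M * signature S), (forall O, nqueries O p <= B + q * k)%N /\
    B.+1%:R * eps * excess W p <= potential W K.
Proof.
have [eps0 pot0] := (ltW eps_gt0, potential_ge0).
have stop n W' K' : coherent W' K' -> closed W' K' ->
    ~ (exists w x, W' w /\ heavy W' K' x) ->
    exists p : oalg (M * signature S), (forall O, nqueries O p <= n + q * k)%N /\
      n.+1%:R * eps * excess W' p <= potential W' K'.
  move=> coh cl light.
  suff [p [np pe]] : exists p : oalg (M * signature S),
      (forall O, nqueries O p <= q * k)%N /\ excess W' p <= 0.
    exists p; split => [ O |]; first exact: leq_trans (np O) (leq_addl _ _).
    by apply: le_trans (pot0 _ _); rewrite mulr_ge0_le0 ?mulr_ge0.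
  have [[w0 Ww0]|W0] := pselect (exists w, W' w).
    by apply: (forge_light d coh cl Ww0) => x hx; apply: light; exists w0, x.
  exists (Return d); split => //; apply: le_trans (excess_le_mass _ _) _.
  by rewrite /mass big_pred0// => w; apply/negP => Ww; apply: W0; exists w.
elim: B W K => [|B IH] W K coh cl;
  (have [[w0 [x [Ww0 hx]]]|] := pselect (exists w x, W w /\ heavy W K x);
    last exact: stop).
  (* The fuel is used up while a heavy point remains: everything may be lost, but the potential
     still covers [eps * mass W]. *)
  exists (Return d); split => //; apply: le_trans (potential_heavy hx).
  by rewrite mul1r -[leLHS]addr0 lerD// ler_wpM2l// excess_le_mass.
(* A heavy point is asked in some world, hence is short; its real answer is therefore the one of the
   finite oracle. *)
have xL : (tag x < L)%N.
  have [_ hm] := hx.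
  have : 0 < mass (fun w => W w && (x \in Q w)).
    apply: lt_le_trans hm; rewrite mulr_gt0//.
    by rewrite /mass (bigD1 w0)//= ltr_pwDl// sumr_ge0// => w _; exact: ltW.
  apply: contraTT => xL; rewrite -leNgt /mass big_pred0// => w.
  by apply/negbTE; apply: contra xL => /andP[_]; exact: bounded.
pose ans w : (tag x).-tuple bool := ev w.1 (tagged x).
pose Wy y w := W w && (ans w == y).
have coh_y y : coherent (Wy y) (x :: K).
  move=> w w' /andP[Ww /eqP wy] /andP[Ww' /eqP wy'].
  have [vw aK] := coh _ _ Ww Ww'; split => // l z /=.
  rewrite in_cons => /predU1P[|]; last exact: aK.
  have H u : u = x -> ev w.1 (tagged u) = ev w'.1 (tagged u).
    by move=> ->; rewrite -[LHS]/(ans w) -[RHS]/(ans w') wy wy'.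
  exact: H.
have cl_y y : closed (Wy y) (x :: K).
  move=> a a' g /andP[Wa /eqP ay] aa'; apply/andP; split.
    apply: (cl a) => // l z /= h; apply: aa' => /=.
    by rewrite in_cons; case/orP: h => ->; rewrite ?orbT.
  rewrite -ay eq_sym; apply/eqP; apply: aa'.
  by case: (x) => l z; rewrite mem_head orbT.
have /choice[f hf] := fun y => IH (Wy y) (x :: K) (coh_y y) (cl_y y).
have split_mass (P : pred world) :
    mass P = \sum_y mass (fun w => P w && (ans w == y)).
  by rewrite /mass (partition_big ans xpredT).
exists (Query (tagged x) f); split => [ O |].
  by rewrite /= addSn ltnS (hf _).1.
have excess_sum : excess W (Query (tagged x) f) <= \sum_y excess (Wy y) (f y).
  rewrite /excess !sumrB -mulr_sumr -split_mass lerD2r.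
  rewrite [X in _ - X]split_mass; apply: lerB; last first.
    by apply: ler_sum => y _; apply: mass_le => w; rewrite /Wy andbAC.
  rewrite /loss split_mass; apply: ler_sum => y _; apply: mass_le => w.
  rewrite /Wy => /andP[/andP[-> lose] wy]; rewrite wy /=.
  apply: contra lose => /asboolP win; apply/asboolP => O wO /=.
  have <- : y = O (tag x) (tagged x).
    by rewrite -(eqP wy); apply: wO; case: (x) xL.
  exact: win.
have B0 : 0 <= B.+1%:R * eps by rewrite mulr_ge0.
apply: le_trans (potential_heavy hx).
(* One share of the excess is paid by the drop of the potential, the other [B.+1] shares by the
   branches over the answers. *)
rewrite -[B.+2%:R]natr1 mulrDl mul1r mulrDl addrC lerD//.
  by rewrite ler_wpM2l// excess_le_mass.
apply: le_trans (ler_wpM2l B0 excess_sum) _; rewrite mulr_sumr.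
rewrite /potential (partition_big ans xpredT) //=; apply: ler_sum => y _.
exact: (hf y).2.
Qed.

(* The initial views partition the worlds; [rep] chooses a world in each class. *)
Lemma attack_exists (B : nat) :
  exists forge : vkey S -> signature S -> oalg (M * signature S),
    (forall O vk s, nqueries O (forge vk s) <= B + q * k)%N /\
    B.+1%:R * eps *
      (mass (fun w => ~~ `[< wins w (forge (view w).1 (view w).2) >]) -
       mass (fun w => bad w alpha) - q%:R * eps * mass xpredT)
    <= q%:R * k%:R * mass xpredT.
Proof.
pose Wv v w := `[< view w = v >].
have coh_v v : coherent (Wv v) [::].
  by move=> w w' /asboolP -> /asboolP ->.
have cl_v v : closed (Wv v) [::].
  move=> a a' g /asboolP av aa'; apply/asboolP; rewrite -av /view /=.
  have [|-> -> //] := agree_gs (O := ev a) (O' := ev a') (g := g) (i := alpha).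
  by move=> l x /= h; apply: aa'; rewrite h.
have /choice[f hf] := fun v : vkey S * signature S =>
  learn B (msg alpha, v.2) (coh_v v) (cl_v v).
exists (fun vk s => f (vk, s)); split => [ O vk s|]; first exact: (hf _).1.
(* Keys and signatures live in arbitrary types, so sums over view classes are indexed by
   representative worlds. *)
pose rep w := odflt w [pick w' | Wv (view w) w'].
have repP w : view (rep w) = view w.
  by rewrite /rep; case: pickP => //= w' /asboolP.
have rep_eq w w' : view w = view w' -> rep w = rep w'.
  move=> e; rewrite /rep e; case: pickP => // /(_ w')/negP[]; exact/asboolP.
have bound r : B.+1%:R * eps *
      (mass (fun w => ~~ `[< wins w (f (view w)) >] && (rep w == r)) -
       mass (fun w => bad w alpha && (rep w == r)) -
       q%:R * eps * mass (fun w => rep w == r))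
    <= q%:R * k%:R * mass (fun w => rep w == r).
  have [er|er] := eqVneq (rep r) r; last first.
    have e0 (P : pred world) : mass (fun w => P w && (rep w == r)) = 0.
      rewrite /mass big_pred0// => w; apply/negP => /andP[_ /eqP e].
      by move/eqP: er; apply; rewrite -{2}e; apply: rep_eq; rewrite -e repP.
    have e1 : mass (fun w => rep w == r) = 0 by rewrite -(e0 xpredT).
    by rewrite !e0 e1 !mulr0 !subr0 mulr0.
  have eW w : (rep w == r) = Wv (view r) w.
    apply/eqP/asboolP => [<-|e]; first by rewrite repP.
    by rewrite -er; apply: rep_eq.
  have eqm (P P' : pred world) : P =1 P' -> mass P = mass P'.
    by move=> PP'; rewrite /mass (eq_bigl _ _ PP').
  have := (hf (view r)).2; rewrite /excess /loss.
  rewrite (eqm (fun w => rep w == r) _ eW).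
  rewrite (@eqm (fun w => Wv _ w && bad w alpha)
    (fun w => bad w alpha && (rep w == r))); last by move=> w; rewrite eW andbC.
  rewrite (@eqm (fun w => Wv _ w && ~~ _)
    (fun w => ~~ `[< wins w (f (view w)) >] && (rep w == r))); last first.
    move=> w; rewrite eW andbC; case E : (Wv _ _); rewrite ?andbF// !andbT.
    by move/asboolP: E => ->.
  move=> /le_trans; apply; rewrite /potential /mass mulr_sumr.
  apply: ler_sum => w _; rewrite mulrC ler_wpM2r ?(ltW (coin_gt0 _))//.
  rewrite -natrM ler_nat; apply: leq_trans (all_trace_size (ev w.1) w.2).
  apply: leq_trans (size_undup _) _; rewrite size_filter; exact: count_size.
have split_mass (P : pred world) :
    mass P = \sum_r mass (fun w => P w && (rep w == r)).
  by rewrite /mass (partition_big rep xpredT).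
under [X in _ * (X - _ - _)]eq_bigl => w do rewrite -surjective_pairing.
rewrite -/(mass _) ![mass xpredT]split_mass (split_mass (fun w => bad _ _)).
rewrite (split_mass (fun w => ~~ _)) !mulr_sumr -!sumrB mulr_sumr.
by apply: ler_sum => r _; exact: bound.
Qed.

End attack.

(** * Random oracles *)

Section random_oracle_theory.
Local Open Scope classical_set_scope.
Variables (R : realType) (d : measure_display) (Omega : measurableType d).
Variables (P : probability Omega R) (O : Omega -> oracle).
Hypothesis ro : random_oracle P O.

Let cyl L (a : finite_oracle L) := [set w | truncate L (O w) = a].

Let cylE L (a : finite_oracle L) :
  cyl a = [set w | forall l, (l < L)%N -> @O w l =1 @ev _ a l].
Proof.
rewrite /cyl; apply/seteqP; split=> w /=.
  by move=> <- l lL x; rewrite ev_truncate.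
move=> h; rewrite -[a]truncate_ev; apply: agree_below_truncate => l x lL.
exact: h.
Qed.

Lemma measurable_truncate L (D : pred (finite_oracle L)) :
  measurable [set w | D (truncate L (O w))].
Proof.
have -> : [set w | D (truncate L (O w))] = \bigcup_(a in [set` D]) cyl a.
  apply/seteqP; split=> w /=; first by move=> h; exists (truncate L (O w)).
  by case=> a /= Da ->.
apply: fin_bigcup_measurable => [|a _]; first exact: finite_finset.
by rewrite cylE; exact: (ro L (ev a)).1.
Qed.

(** All cylinders have the same probability [c]; applying the count to the whole space gives the
    value of [c] without computing the cardinality. *)
Lemma prob_truncate L (D : pred (finite_oracle L)) :
  P [set w | D (truncate L (O w))] = (#|D|%:R / #|finite_oracle L|%:R)%:E.
Proof.
pose c : R := \prod_(l < L) (#|{ffun l.-tuple bool -> l.-tuple bool}|%:R)^-1.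
have H (E : pred (finite_oracle L)) : P [set w | E (truncate L (O w))] = (#|E|%:R * c)%:E.
  have -> : [set w | E (truncate L (O w))] = \bigcup_(a in [set` E]) cyl a.
    apply/seteqP; split=> w /=; first by move=> h; exists (truncate L (O w)).
    by case=> a /= Da ->.
  rewrite measure_fin_bigcup; last first.
  - by move=> a _; rewrite cylE; exact: (ro L (ev a)).1.
  - by move=> a b _ _ [w [/= <- <-]].
  - exact: finite_finset.
  rewrite -(@bigfs _ _ _ _ (enum E)) ?enum_uniq//; last first.
    by move=> a Ea; rewrite mem_enum [a \in E]Ea.
  rewrite big_mkcond big_enum /= -big_mkcondr /=.
  rewrite (eq_bigr (fun=> c%:E)) => [|a _]; last by rewrite cylE; exact: (ro L (ev a)).2.
  rewrite sumEFin sumr_const -[X in X%:E = _]mulr_natl; congr ((_%:R * _)%:E).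
  by apply: eq_card => a; rewrite -!topredE /= andbb.
have c1 : #|finite_oracle L|%:R * c = 1.
  have := H xpredT; rewrite (_ : [set w | _] = setT); last by apply/seteqP.
  by rewrite probability_setT => -[<-].
have N0 : #|finite_oracle L|%:R != 0 :> R.
  by apply/eqP => N0; move: c1; rewrite N0 mul0r => /esym/eqP; rewrite oner_eq0.
rewrite H; congr (_ * _)%:E; apply: (mulfI N0).
by rewrite c1 mulfV.
Qed.

(* A run depends only on strings of bounded length, as query trees are finite. *)
Lemma measurable_run (A : Type) (p : oalg A) (D : A -> Prop) :
  measurable [set w | D (run (O w) p)].
Proof.
have [L hL] := trace_level_bounded p.
rewrite (_ : [set w | _] =
  [set w | `[< D (run (ev (truncate L (O w))) p) >]]); last first.
  have e w : run (O w) p = run (ev (truncate L (O w))) p.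
    apply: (proj1 (agree_run (D := fun x => (tag x < L)%N) _ _)).
      by move=> x /hL.
    exact: ev_truncate.
  by apply/seteqP; split=> w /=; rewrite e => /asboolP.
exact: (measurable_truncate (fun a => `[< D (run (ev a) p) >])).
Qed.

End random_oracle_theory.

(** * Coins, the game and its success probability *)

Definition trivial_coins (R : realType) : coins R.
Proof.
refine (@Coins R unit (fun=> 1) (fun=> ler01) _).
by rewrite (_ : setT = [set tt])%classic ?esum_set1//; apply/seteqP; split => // -[].
Defined.

(** The whole experiment as one oracle algorithm, so that [measurable_run] makes breaking the scheme
    an event. *)
Definition game (R : realType) (M : Type) (S : scheme R M) (A : adversary S) g a
    : oalg Prop :=
  oalg_bind (gen g) (fun kp =>
  oalg_bind (sign kp.1 (adv_msg a)) (fun s =>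
  oalg_bind (adv_forge (a := A) a kp.2 s) (fun r =>
  oalg_bind (ver kp.2 r.1 r.2) (fun b => Return (r.1 <> adv_msg a /\ b = true))))).

Lemma run_game (R : realType) (M : Type) (S : scheme R M) (A : adversary S) O g a :
  run O (game (A := A) g a) = breaks (A := A) O g a.
Proof.
rewrite /game /breaks !run_bind; case: (run O (gen g)) => sk vk /=.
by case: (run O (adv_forge _ _ _)) => m s.
Qed.

Lemma coins_finite_approx (R : realType) (c : coins R) (eta : R) : 0 < eta ->
  exists (n : nat) (f : 'I_n -> outcome c), injective f /\
    (forall i, 0 < Defs.pmf (f i)) /\ 1 - eta <= \sum_i Defs.pmf (f i) <= 1.
Proof.
move=> eta0.
have [X finX hX] : exists2 X : set (outcome c), finite_set X &
    (((1 - eta)%:E : \bar R) <= \sum_(x \in X) (Defs.pmf x)%:E)%E.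
  apply: contrapT => no; have : ((1 : \bar R) <= (1 - eta)%:E)%E.
    rewrite -(pmf_sum1 c); apply: ge_ereal_sup => _ [X [finX _] <-].
    by rewrite leNgt; apply/negP => h; apply: no; exists X => //; exact: ltW.
  by rewrite lee_fin; lra.
(* Outcomes of probability 0 are dropped, since completeness and the query bound speak only of the
   others. *)
pose s := [seq x : outcome c <- finmap.enum_fset (fset_set X) | 0 < Defs.pmf x].
have us : uniq s by rewrite filter_uniq ?finmap.fset_uniq.
exists (size s), (tnth (in_tuple s)); split; first exact/tuple_uniqP.
split=> [i|].
  by have := mem_tnth i (in_tuple s); rewrite mem_filter => /andP[].
have -> : \sum_i Defs.pmf (tnth (in_tuple s) i) = \sum_(x <- s) Defs.pmf x.
  by rewrite [RHS]big_tnth.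
have e : \sum_(x <- s) Defs.pmf x = \sum_(x <- finmap.enum_fset (fset_set X)) Defs.pmf x.
  rewrite big_filter [RHS](bigID (fun x => 0 < Defs.pmf x)) /= [X in _ + X]big1 ?addr0//.
  move=> x; rewrite -leNgt => h; apply/eqP; rewrite eq_le h; exact: Defs.pmf_ge0.
rewrite e -!lee_fin -sumEFin -fsbig_finite// hX /= -(pmf_sum1 c).
by apply: esum_ge; exists X.
Qed.

Lemma honest_level_bounded (R : realType) (M : Type) (S : scheme R M) (k : nat)
    (msg : 'I_k -> M) (G : finType) (coin : G -> outcome (gen_coins S)) :
  exists L, forall O g x, x \in all_trace msg coin O g -> (tag x < L)%N.
Proof.
pose honest (gi : G * 'I_k) := oalg_bind (gen (coin gi.1)) (fun kp =>
  oalg_bind (sign kp.1 (msg gi.2)) (fun s => ver kp.2 (msg gi.2) s)).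
have /choice[f hf] := fun gi => trace_level_bounded (honest gi).
exists (\max_gi f gi) => O g x /all_traceP[i xi].
apply: leq_trans (leq_bigmax (g, i)); apply: (hf (g, i) O).
rewrite /honest !trace_bind /=; move: xi.
by rewrite /gs_trace /ver_trace /honest_sig /keys !mem_cat orbA.
Qed.

Section success.
Variables (R : realType) (M : Type) (S : scheme R M) (k : nat) (msg : 'I_k -> M).
Variables (G : finType) (coin : G -> outcome (gen_coins S)).
Hypothesis coin_inj : injective coin.
Variables (L : nat).
Hypothesis bounded : forall O g x, x \in all_trace msg coin O g -> (tag x < L)%N.
Variables (alpha : 'I_k) (forge : vkey S -> signature S -> oalg (M * signature S)).

Definition attack : adversary S :=
  @Adversary R M S (trivial_coins R) (fun=> msg alpha) (fun=> forge).

Definition forges (w : world G L) : bool :=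
  `[< wins msg coin alpha w (forge (view msg coin alpha w).1 (view msg coin alpha w).2) >].

Lemma forges_breaks O g : forges (truncate L O, g) ->
  breaks (A := attack) O (coin g) tt.
Proof.
move=> /asboolP/(_ O (@ev_truncate L O)); rewrite /view /=.
have hO : agree (mem (all_trace msg coin (ev (truncate L O)) g)) (ev (truncate L O)) O.
  by move=> l x h; apply: ev_truncate; exact: (bounded h).
have [<- <- _ _] := agree_all hO alpha.
rewrite /breaks /honest_sig /keys /=; case: (run O (gen (coin g))) => sk vk /=.
by case: (run O (forge _ _)).
Qed.

(** Only the finitely many key generation coins in the range of [coin] are summed; all others count
    as failures. *)
Lemma success_prob_ge (d : measure_display) (Omega : measurableType d)
    (P : probability Omega R) (O : Omega -> oracle) : random_oracle P O ->
  ((mass coin forges / #|finite_oracle L|%:R)%:E <= success_prob attack P O)%E.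
Proof.
move=> ro; pose r := [seq (coin g, tt) | g <- enum G].
have ur : uniq r by rewrite map_inj_uniq ?enum_uniq// => g h [/coin_inj].
apply: esum_ge; exists [set` r]%classic; first by split => //; exact: finite_seq.
rewrite -fsbig_seq// big_map big_enum /=.
apply: (@le_trans _ _ (\sum_g (Defs.pmf (coin g) *
    (#|[pred a | forges (a, g)]|%:R / #|finite_oracle L|%:R))%:E)%E).
  rewrite sumEFin lee_fin /mass.
  rewrite (eq_bigl (fun w : world G L => xpredT w.1 && forges (w.1, w.2))); last by case.
  rewrite -(pair_big_dep xpredT (fun a g => forges (a, g)) (fun a g => Defs.pmf (coin g))) /=.
  rewrite (exchange_big_dep xpredT)//= mulr_suml; apply: ler_sum => g _.
  by rewrite sumr_const -[X in X / _ <= _]mulr_natr -mulrA.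
apply: lee_sum => g _; rewrite mulr1 EFinM; apply: lee_wpmul2l.
  by rewrite lee_fin; exact: Defs.pmf_ge0.
rewrite -(prob_truncate ro [pred a | forges (a, g)]).
apply: le_measure; rewrite ?inE.
- exact: (measurable_truncate ro [pred a | forges (a, g)]).
- rewrite (_ : [set w | _]%classic = [set w | id (run (O w) (game (A := attack) (coin g) tt))]%classic).
    exact: (measurable_run ro (game (A := attack) (coin g) tt) id).
  by apply/seteqP; split => w /=; rewrite run_game.
- by move=> w; exact: forges_breaks.
Qed.

End success.

(** * Choice of the message and of the constants *)

Lemma exists_seldom_bad (R : realType) (M : Type) (S : scheme R M) (q : nat)
    (k : nat) (msg : 'I_k -> M) (G : finType) (coin : G -> outcome (gen_coins S))
    (L : nat) (lambda : R) :
  total_queries_le S q -> (forall g, 0 < Defs.pmf (coin g)) -> (0 < k)%N ->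
  'C(q, q %/ 2)%:R <= lambda * k%:R ->
  exists i, mass coin (fun w : world G L => bad msg coin w i) <=
    lambda * mass coin (xpredT : pred (world G L)).
Proof.
move=> tot coin0 k0 Ck; apply: contrapT => no.
pose m := mass coin (xpredT : pred (world G L)).
have : \sum_(i < k) lambda * m <
    \sum_(i < k) mass coin (fun w : world G L => bad msg coin w i).
  apply: ltr_sum => [|i _].
    by apply/hasP; exists (Ordinal k0); rewrite ?mem_index_enum.
  by rewrite ltNge; apply/negP => h; apply: no; exists i.
(* Double counting: by [card_bad] each world is bad for at most ['C(q, q %/ 2)] messages, which is
   at most [lambda * k]. *)
apply/negP; rewrite -leNgt sumr_const card_ord -mulr_natr mulrAC /mass.
under eq_bigr do rewrite big_mkcond /=.
rewrite exchange_big /= mulr_sumr; apply: ler_sum => w _.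
rewrite -big_mkcond sumr_const -[X in X <= _]mulr_natl ler_wpM2r ?(ltW (coin0 _))//.
by apply: le_trans Ck; rewrite ler_nat; exact: (card_bad tot msg coin0).
Qed.

Lemma central_bin_bound (R : realType) (q : nat) (D : R) : 0 < D ->
  q%:R ^+ 2 * 'C(q, q %/ 2)%:R / D <= 1 * (q%:R `^ (3 / 2) * 2 ^+ q / D).
Proof.
move=> D0; rewrite mul1r ler_pM2r ?invr_gt0//.
have [->|q0] := posnP q; first by rewrite expr0n /= mul0r mulr_ge0 ?powR_ge0 ?exprn_ge0.
have qp : 0 < q%:R :> R by rewrite ltr0n.
have -> : q%:R `^ (3 / 2) = q%:R * Num.sqrt q%:R :> R.
  rewrite (_ : 3 / 2 = 1 + 2^-1); last by field.
  by rewrite powRD ?powRr1 ?powR12_sqrt// (gt_eqF qp) implybT.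
have sq : Num.sqrt q%:R ^+ 2 = q%:R :> R by rewrite sqr_sqrtr// ltW.
rewrite expr2 -!mulrA ler_pM2l// -{1}sq expr2 -mulrA ler_pM2l ?sqrtr_gt0//.
rewrite -(@ler_pXn2r _ 2) ?nnegrE ?mulr_ge0 ?exprn_ge0 ?sqrtr_ge0//.
rewrite exprMn sq mulrC -exprM mulnC exprM -!natrX -natrM ler_nat.
exact: bin_central_sqr_le.
Qed.

(** The budget: [lambda] for bad worlds, and [delta / 4] each for the dropped coins, the light hits
    and running out of fuel. *)
Lemma attack_probability (R : realFieldType) (N m bd ls e Y Z lambda delta : R) :
  0 < N -> 1 - delta / 4 <= m -> m <= 1 -> 0 < lambda -> 0 < delta ->
  bd <= lambda * (N * m) -> e <= delta / 4 ->
  0 < Y -> Z <= Y * (delta / 4) -> 0 <= N * m ->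
  Y * (ls - bd - e * (N * m)) <= Z * (N * m) ->
  1 - (lambda + delta) <= (N * m - ls) / N.
Proof.
move=> N0 m0 m1 l0 d0 hb he Y0 hZ Nm0 H.
have h1 : ls - bd - e * (N * m) <= delta / 4 * (N * m).
  rewrite -(ler_pM2l Y0); apply: le_trans H _; rewrite [leRHS]mulrA.
  exact: ler_wpM2r.
have h2 : e * (N * m) <= delta / 4 * (N * m) by exact: ler_wpM2r.
have h3 : ls <= (lambda + delta / 2) * (N * m) by lra.
have h4 : (lambda + delta / 2) * m <= lambda + delta / 2.
  by rewrite ler_piMr//; lra.
rewrite ler_pdivlMr// mulrC -subr_ge0.
have h5 : (lambda + delta / 2) * (N * m) <= N * (lambda + delta / 2).
  by rewrite mulrCA ler_pM2l.
have : 0 <= N * (m - (1 - delta / 4)) by rewrite mulr_ge0 ?(ltW N0)//; lra.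
have : 0 <= N * delta by rewrite mulr_ge0 ?(ltW N0)//; lra.
lra.
Qed.

(** The constant 32 is 16 from the two divisions of [delta] by 4, times 2 because [q + 1 <= 2 q] for
    positive [q]. *)
Lemma fuel_suffices (R : realType) (q k : nat) (delta : R) : 0 < delta ->
  q%:R * k%:R <= (Num.truncn (32 * q%:R ^+ 2 * k%:R / delta ^+ 2)).+1%:R *
    (delta / (4 * q.+1%:R)) * (delta / 4).
Proof.
move=> d0; set x := 32 * _ * _ / _.
have x0 : 0 <= x by rewrite !mulr_ge0 ?invr_ge0 ?exprn_ge0 ?(ltW d0).
have q1 : (0 : R) < q.+1%:R by rewrite ltr0n.
apply: (@le_trans _ _ (x * (delta / (4 * q.+1%:R)) * (delta / 4))); last first.
  rewrite !ler_wpM2r ?divr_ge0 ?mulr_ge0 ?(ltW d0) ?(ltW q1)//.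
  by rewrite ltW// truncnS_gt.
have -> : x * (delta / (4 * q.+1%:R)) * (delta / 4) =
    2 * q%:R ^+ 2 * k%:R / q.+1%:R.
  rewrite /x; move: (q.+1%:R : R) q1 => t t0.
  by field; rewrite (gt_eqF d0) (gt_eqF t0).
rewrite ler_pdivlMr// mulrAC ler_wpM2r// -natrX -!natrM ler_nat; nia.
Qed.

Theorem theorem4p1 (R : realType) :
  exists C C' : R, 0 < C /\ 0 < C' /\
  forall (M : Type) (S : scheme R M) (q : nat) (lambda delta : R),
    perfectly_complete S -> total_queries_le S q ->
    0 < lambda -> 0 < delta ->
    card_ge M ('C(q, q %/ 2)%:R / lambda) ->
    let bound1 := q%:R ^+ 2 * 'C(q, q %/ 2)%:R / (lambda * delta ^+ 2) in
    let bound2 := q%:R `^ (3 / 2) * 2 ^+ q / (lambda * delta ^+ 2) in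
    bound1 <= C' * bound2 /\
    exists A : adversary S,
      adv_queries_le A (C * bound1) /\
      forall (d : measure_display) (Omega : measurableType d)
             (P : probability Omega R) (O : Omega -> oracle),
        random_oracle P O ->
        ((1 - (lambda + delta))%:E <= success_prob A P O)%E.
Proof.
(* Learning costs 32 units and forging 1; rounding the number of messages up to an integer doubles
   the 33. *)
exists 66, 1; split; first lra; split; first lra.
move=> M S q lambda delta complete total l0 d0 [n hn cardM] bound1 bound2.
split; first by apply: central_bin_bound; rewrite mulr_gt0 ?exprn_gt0.
pose c := 'C(q, q %/ 2)%:R : R.
have c1 : 1 <= c by rewrite /c ler1n bin_gt0 leq_div.
have r0 : 0 < c / lambda by rewrite divr_gt0//; lra.
have b0 : 0 <= bound1.
  by rewrite !mulr_ge0 ?invr_ge0 ?mulr_ge0 ?exprn_ge0 ?(ltW l0) ?(ltW d0).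
have [msgn msgn_inj] : exists f : 'I_n -> M, injective f.
  have [f] := card_leP cardM.
  have iI (i : 'I_n) : nat_of_ord i \in (`I_n)%classic by rewrite inE /=.
  exists (fun i => val (f (SigSub (iI i)))) => i j /val_inj fij; apply: val_inj.
  by have [] := @inj _ _ _ f _ _ (mem_set I) (mem_set I) fij.
(* If [lambda + delta >= 1], nothing has to be achieved and an adversary without queries suffices.
   Otherwise both are below 1. *)
have [big|small] := leP 1 (lambda + delta).
  have n0 : (0 < n)%N by rewrite -(ltr0n R); apply: lt_le_trans hn.
  exists (@Adversary R M S (trivial_coins R) (fun=> msgn (Ordinal n0))
    (fun _ _ s => Return (msgn (Ordinal n0), s))); split.
    by move=> O a vk s /=; rewrite mulr_ge0.
  move=> d Omega P O ro; apply: (@le_trans _ _ 0%E); first by rewrite lee_fin; lra.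
  apply: esum_ge0 => cc _; rewrite mule_ge0//.
  by rewrite lee_fin mulr_ge0//; exact: Defs.pmf_ge0.
(* The attack uses only the least sufficient number [k] of messages, so its cost does not grow with
   the message space. *)
have exk : exists j : nat, c / lambda <= j%:R by exists n.
case: (ex_minnP exk) => k ck kmin.
have kn : (k <= n)%N by exact: kmin.
have k0 : (0 < k)%N by rewrite -(ltr0n R); apply: lt_le_trans ck.
have k2 : k%:R <= 2 * (c / lambda).
  have : k.-1%:R < c / lambda.
    by rewrite ltNge; apply/negP => /kmin; rewrite leqNgt prednK ?leqnn.
  have : 1 <= c / lambda by rewrite ler_pdivlMr// mul1r; lra.
  have -> : k%:R = k.-1%:R + 1 :> R by rewrite natr1 prednK.
  by lra.
pose msg i := msgn (widen_ord kn i).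
have msg_inj : injective msg.
  by move=> i j /msgn_inj/(congr1 val) /= ij; exact: val_inj.
have [|N [coin [coin_inj [coin0 /andP[m0 m1]]]]] :=
  coins_finite_approx (gen_coins S) (eta := delta / 4); first lra.
have [L bounded] := honest_level_bounded msg coin.
have Ck : 'C(q, q %/ 2)%:R <= lambda * k%:R by rewrite mulrC -ler_pdivrMr.
have [alpha seldom] := exists_seldom_bad msg L total coin0 k0 Ck.
have q1 : (0 : R) < 4 * q.+1%:R by rewrite mulr_gt0 ?ltr0n.
(* This makes [q * eps] at most [delta / 4]; the successor keeps the denominator nonzero when [q] is
   0. *)
pose eps : R := delta / (4 * q.+1%:R).
have eps0 : 0 < eps by rewrite divr_gt0.
have q14 : 4 <= 4 * q.+1%:R :> R by rewrite ler_peMr// ler1n.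
have eps1 : eps <= 1 by rewrite ler_pdivrMr// mul1r; lra.
pose B := Num.truncn (32 * q%:R ^+ 2 * k%:R / delta ^+ 2).
have [forge [nforge hforge]] :=
  attack_exists complete total msg_inj coin0 bounded alpha eps0 eps1 B.
exists (attack msg alpha forge); split.
  move=> O a vk s; rewrite /attack /=.
  apply: (@le_trans _ _ (B + q * k)%:R); first by rewrite ler_nat nforge.
  have d2 : 0 < delta ^+ 2 by rewrite exprn_gt0.
  have hB : B%:R <= 32 * q%:R ^+ 2 * k%:R / delta ^+ 2.
    by rewrite truncn_le !mulr_ge0 ?invr_ge0 ?(ltW d2).
  have hq : (q * k)%:R <= q%:R ^+ 2 * k%:R / delta ^+ 2 :> R.
    rewrite ler_pdivlMr// natrM -natrX.
    apply: (@le_trans _ _ (q%:R * k%:R * 1)).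
      by rewrite ler_wpM2l ?mulr_ge0// expr_le1 ?(ltW d0)//; lra.
    by rewrite mulr1 ler_wpM2r// ler_nat; case: (q) => // j; rewrite leq_pmulr.
  rewrite natrD; apply: le_trans (lerD hB hq) _.
  have -> : 32 * q%:R ^+ 2 * k%:R / delta ^+ 2 + q%:R ^+ 2 * k%:R / delta ^+ 2 =
    33 * q%:R ^+ 2 / delta ^+ 2 * k%:R by field; rewrite (gt_eqF d0).
  have -> : 66 * bound1 = 33 * q%:R ^+ 2 / delta ^+ 2 * (2 * (c / lambda)).
    by rewrite /bound1 /c; field; rewrite (gt_eqF d0) (gt_eqF l0).
  by rewrite ler_wpM2l// !mulr_ge0 ?invr_ge0 ?(ltW d2).
move=> d Omega P O ro.
apply: le_trans (success_prob_ge coin_inj bounded alpha forge ro).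
rewrite lee_fin.
have N0 : (0 : R) < #|finite_oracle L|%:R.
  by rewrite ltr0n; apply/card_gt0P; exists (truncate L (fun l x => x)).
pose m := \sum_i Defs.pmf (coin i).
have massT : mass coin (xpredT : pred (world 'I_N L)) = #|finite_oracle L|%:R * m.
  rewrite /mass -(pair_big xpredT xpredT (fun (a : finite_oracle L) g => Defs.pmf (coin g))) /=.
  by rewrite sumr_const -[LHS]mulr_natl.
have massF : mass coin (forges msg coin alpha (L := L) forge) =
    #|finite_oracle L|%:R * m -
    mass coin (fun w : world 'I_N L => ~~ forges msg coin alpha forge w).
  rewrite -massT /mass [in RHS](bigID (forges msg coin alpha (L := L) forge)) /=.
  by rewrite addrK.
rewrite massF.
apply: (attack_probability (m := m) (e := q%:R * eps) (Y := B.+1%:R * eps)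
  (Z := q%:R * k%:R) (bd := mass coin (fun w : world _ L => bad msg coin w alpha))) => //.
- by rewrite -massT; exact: seldom.
- rewrite /eps mulrA ler_pdivrMr// mulrC -[leRHS]mulrA [X in _ <= _ * X]mulrA.
  by rewrite mulVf// mul1r ler_wpM2l ?(ltW d0)// ler_nat.
- by rewrite mulr_gt0.
- exact: fuel_suffices.
- by rewrite -massT; apply: mass_ge0.
- by rewrite -massT.
Qed.
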